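(* (i) For every clear grand-coalition-first action model $M=(ST,AC,out_{AG},L)$, with determined successor function $suc$ and determined outcome functions $out_{\{a\}}$ ($a\in AG$), the tuple $(ST,AC,suc,\{out_{\{a\}}\}_{a\in AG},L)$ is a single-coalition-first action model, and the action model it determines coincides with the action model determined by $M$ (all outcome and availability functions for all coalitions agree). (ii) There is a single-coalition-first action model whose determined grand-coalition outcome function $out_{AG}$ is such that the grand-coalition-first action model $(ST,AC,out_{AG},L)$ is not clear.
   Context: $AG$ is a finite nonempty set of agents, $AP$ a countable set of atomic propositions. For a nonempty set $AC$ and $C\subseteq AG$, $JA_C$ is the set of functions $\sigma_C:C\to AC$ ($JA_\emptyset=\{\emptyset\}$); $\sigma_C\subseteq\sigma_{AG}$ means $\sigma_C$ is the restriction of $\sigma_{AG}$ to $C$; $\sigma_C|_{\{a\}}$ is the restriction to $\{a\}$. A grand-coalition-first action model is $(ST,AC,out_{AG},L)$ with $ST,AC$ nonempty, $out_{AG}:ST\times JA_{AG}\to\mathcal P(ST)$, $L:ST\to\mathcal P(AP)$. It determines $out_C(s,\sigma_C)=\bigcup\{out_{AG}(s,\sigma_{AG})\mid\sigma_C\subseteq\sigma_{AG}\}$, $av_C(s)=\{\sigma_C\in JA_C\mid out_C(s,\sigma_C)\neq\emptyset\}$, and $suc(s)=\bigcup\{out_{AG}(s,\sigma_{AG})\mid\sigma_{AG}\in JA_{AG}\}$. It is clear if for all $s$ and $\sigma_{AG}\neq\sigma'_{AG}$, $out_{AG}(s,\sigma_{AG})\cap out_{AG}(s,\sigma'_{AG})=\emptyset$.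 A single-coalition-first action model is $(ST,AC,suc,\{out_a\}_{a\in AG},L)$ with $suc:ST\to\mathcal P(ST)$ and $out_a:ST\times JA_{\{a\}}\to\mathcal P(ST)$ such that $\bigcup\{out_a(s,\sigma_a)\mid\sigma_a\in JA_{\{a\}}\}=suc(s)$ for every $s$. It determines $out_\emptyset(s,\emptyset)=suc(s)$, $out_C(s,\sigma_C)=\bigcap\{out_a(s,\sigma_C|_{\{a\}})\mid a\in C\}$ for nonempty $C$, and $av_C(s)=\{\sigma_C\mid out_C(s,\sigma_C)\neq\emptyset\}$. *)

(* Defs.v *)
From mathcomp Require Import all_boot.
From mathcomp Require Import boolp classical_sets.

Set Implicit Arguments.
Unset Strict Implicit.
Unset Printing Implicit Defensive.

Local Open Scope classical_set_scope.

(* Coalitions are finite sets [{set AG}] of agents, with the finset notations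
   delimited by %SET; sets of states, joint actions and atomic propositions are
   classical sets [set T := T -> Prop]. *)

Section ActionModels.
Variables (AG : finType) (AP : countType).

Section JointActions.
Variable AC : Type.

Definition member (C : {set AG}) : Type := {a : AG | a \in C}.

(* Finite functions are used so that pointwise equal joint actions are equal
   and JA set0 is a singleton. *)
Definition JA (C : {set AG}) : Type := {ffun {a : AG | a \in C} -> AC}.

Definition member_incl (C D : {set AG}) (sCD : C \subset D)
    (x : member C) : member D :=
  exist _ (val x) (fintype.subsetP sCD (val x) (valP x)).

Definition restr (C D : {set AG}) (sCD : C \subset D) (sigma : JA D) : JA C :=
  [ffun x => sigma (member_incl sCD x)].

Lemma sub1_member (C : {set AG}) (x : member C) : [set val x]%SET \subset C.
Proof. by rewrite finset.sub1set; exact: valP x. Qed.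

Definition restr1 (C : {set AG}) (sigma : JA C) (x : member C) :
    JA [set val x]%SET :=
  restr (sub1_member x) sigma.

Definition extends (C : {set AG}) (sigmaC : JA C) (sigma : JA [set: AG]%SET) :
    Prop :=
  restr (finset.subsetT C) sigma = sigmaC.

End JointActions.

Record action_model (ST AC : Type) := ActionModel {
  am_out : forall C : {set AG}, ST -> JA AC C -> set ST;
  am_av : forall C : {set AG}, ST -> set (JA AC C);
  am_label : ST -> set AP
}.

Record grand_first := GrandFirst {
  gST : Type;
  gAC : Type;
  gST_inhabited : inhabited gST;
  gAC_inhabited : inhabited gAC;
  gout : gST -> JA gAC [set: AG]%SET -> set gST;
  glabel : gST -> set AP
}.

Definition grand_out (M : grand_first) (C : {set AG}) (s : gST M)
    (sigmaC : JA (gAC M) C) : set (gST M) :=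
  \bigcup_(sigma in [set sigma | extends sigmaC sigma]) gout s sigma.

Definition grand_av (M : grand_first) (C : {set AG}) (s : gST M) :
    set (JA (gAC M) C) :=
  [set sigmaC | grand_out s sigmaC !=set0].

Definition grand_suc (M : grand_first) (s : gST M) : set (gST M) :=
  \bigcup_(sigma in [set: JA (gAC M) [set: AG]%SET]) gout s sigma.

Definition grand_determined (M : grand_first) :
    action_model (gST M) (gAC M) :=
  ActionModel (@grand_out M) (@grand_av M) (@glabel M).

Definition clear (M : grand_first) : Prop :=
  forall (s : gST M) (sigma sigma' : JA (gAC M) [set: AG]%SET),
    sigma <> sigma' -> gout s sigma `&` gout s sigma' = set0.

Definition single_cover (ST AC : Type) (suc : ST -> set ST)
    (out : forall a : AG, ST -> JA AC [set a]%SET -> set ST) : Prop :=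
  forall (s : ST) (a : AG),
    \bigcup_(sigma in [set: JA AC [set a]%SET]) out a s sigma = suc s.

Record single_first := SingleFirst {
  sST : Type;
  sAC : Type;
  sST_inhabited : inhabited sST;
  sAC_inhabited : inhabited sAC;
  ssuc : sST -> set sST;
  sout : forall a : AG, sST -> JA sAC [set a]%SET -> set sST;
  slabel : sST -> set AP;
  scover : single_cover ssuc sout
}.

Definition single_out (N : single_first) (C : {set AG}) (s : sST N)
    (sigmaC : JA (sAC N) C) : set (sST N) :=
  if C == finset.set0 then ssuc s
  else \bigcap_(x in [set: member C]) sout s (restr1 sigmaC x).

Definition single_av (N : single_first) (C : {set AG}) (s : sST N) :
    set (JA (sAC N) C) :=
  [set sigmaC | single_out s sigmaC !=set0].

Definition single_determined (N : single_first) :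
    action_model (sST N) (sAC N) :=
  ActionModel (@single_out N) (@single_av N) (@slabel N).

Definition grand_of_single (N : single_first) : grand_first :=
  GrandFirst (sST_inhabited N) (sAC_inhabited N)
    (@single_out N [set: AG]%SET) (@slabel N).

Definition single_of_grand (M : grand_first)
    (cover : single_cover (@grand_suc M)
               (fun a : AG => @grand_out M [set a]%SET)) : single_first :=
  SingleFirst (gST_inhabited M) (gAC_inhabited M) (@glabel M) cover.

End ActionModels.

(* Main.v *)
Require Import Defs.
From mathcomp Require Import all_boot.
From mathcomp Require Import boolp classical_sets.

(** In a clear model each outcome of a state [s] is produced by exactly one grand
    joint action.  A state lying in every [out_a(s, sigma_C|_a)] with [a] in [C]
    is therefore produced by a single joint action agreeing with [sigma_C] at
    every agent of [C], i.e. extending [sigma_C].  For the second part, a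
    one-state model in which every action of every agent yields that state is
    never clear once two actions are available. *)

Lemma clear_gout_inj {AG : finType} {AP : countType} {M : grand_first AG AP}
    {s t : gST M} {sigma sigma' : JA (gAC M) [set: AG]%SET} :
  clear M -> gout s sigma t -> gout s sigma' t -> sigma = sigma'.
Proof.
move=> clM st st'; apply: contrapT => /(clM s) disj.
by have : set0 t by rewrite -disj.
Qed.

(** A joint action is determined by its values at single agents, so agreement on [C] can be tested
    one agent at a time. The membership proofs carried by the arguments differ, but [val_inj]
    identifies them. *)
Lemma extends_restr1P {AG : finType} {AC : Type} {C : {set AG}}
    {sigmaC : JA AC C} {sigma : JA AC [set: AG]%SET} :
  extends sigmaC sigma <->
  forall x : member C, extends (restr1 sigmaC x) sigma.
Proof.
split=> [<- x|ext].
  apply/ffunP=> y; rewrite !ffunE; congr (sigma _); exact: val_inj.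
apply/ffunP=> x; rewrite ffunE.
pose y : member [set val x]%SET := exist _ (val x) (set11 (val x)).
have /ffunP/(_ y) := ext x; rewrite !ffunE => e.
transitivity (sigma (member_incl (finset.subsetT [set val x]%SET) y)).
  by congr (sigma _); exact: val_inj.
by rewrite e; congr (sigmaC _); exact: val_inj.
Qed.

(** Every grand joint action extends its own restriction to [a], so grouping by that restriction
    loses no outcome. *)
Lemma grand_out_cover (AG : finType) (AP : countType) (M : grand_first AG AP) :
  single_cover (@grand_suc AG AP M)
    (fun a : AG => @grand_out AG AP M [set a]%SET).
Proof.
move=> s a; apply/seteqP; split=> t.
  by case=> _ _ [sigma _ st]; exists sigma.
case=> sigma _ st; exists (restr (finset.subsetT _) sigma) => //.
by exists sigma.
Qed.

Lemma single_out_of_grand (AG : finType) (AP : countType)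
    (M : grand_first AG AP)
    (cover : single_cover (@grand_suc AG AP M)
               (fun a : AG => @grand_out AG AP M [set a]%SET))
    (C : {set AG}) (s : gST M) (sigmaC : JA (gAC M) C) :
  clear M ->
  @single_out AG AP (single_of_grand cover) C s sigmaC = grand_out s sigmaC.
Proof.
move=> clM; rewrite /single_out; case: eqP => [C0|/eqP/set0Pn[a aC]].
  apply/seteqP; split=> t [sigma _ st]; exists sigma => //=.
  (* The agentwise test is vacuous on the empty coalition. *)
  by apply/extends_restr1P; case=> x xC; exfalso; rewrite C0 inE in xC.
apply/seteqP; split=> t /=.
  (* The agent [a] supplies the witness [sigma]; clearness then identifies it with the joint action
     obtained from any other [x]. *)
  move=> tC; have [sigma _ st] := tC (exist _ a aC) I.
  exists sigma => //; apply/extends_restr1P => x.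
  have [sigma' ext' st'] := tC x I.
  by rewrite (clear_gout_inj clM st st').
case=> sigma /extends_restr1P ext st x _.
by exists sigma => //; exact: ext.
Qed.

Lemma unit_bool_cover (AG : finType) :
  @single_cover AG unit bool (fun=> setT) (fun _ _ _ => setT).
Proof.
by move=> s a; apply/seteqP; split=> t // _; exists [ffun=> true].
Qed.

Theorem theorem5p4 (AG : finType) (AP : countType) (AG_nonempty : 0 < #|AG|) :
  (forall M : grand_first AG AP, clear M ->
     exists cover : single_cover (@grand_suc AG AP M)
                      (fun a : AG => @grand_out AG AP M [set a]%SET),
       single_determined (single_of_grand cover) = grand_determined M)
  /\
  (exists N : single_first AG AP, ~ clear (grand_of_single N)).
Proof.
split=> [M clM|].
  exists (grand_out_cover AG AP M).
  have outE : @single_out AG AP (single_of_grand (grand_out_cover AG AP M)) =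
              @grand_out AG AP M.
    apply: functional_extensionality_dep => C; apply/funext => s.
    by apply/funext => sigmaC; exact: single_out_of_grand.
  by rewrite /single_determined /grand_determined /single_av outE.
pose N : single_first AG AP :=
  SingleFirst (inhabits tt) (inhabits true) (fun=> set0) (unit_bool_cover AG).
exists N => clN; have /card_gt0P[a _] := AG_nonempty.
pose cst (b : bool) : JA bool [set: AG]%SET := [ffun=> b].
(* The agent [a] separates the two constants; with no agents they would coincide. *)
have cst_neq : cst true <> cst false.
  by move=> /ffunP/(_ (exist _ a (finset.in_setT a))); rewrite !ffunE.
have out_cst b : gout (g := grand_of_single N) tt (cst b) tt.
  by rewrite /= /single_out; case: ifP.
have := clN tt _ _ cst_neq.
by move=> /seteqP[/(_ tt) + _]; apply; split; exact: out_cst.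
Qed.
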